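(* Let $K\subseteq\mathbb{R}^n$ be a nonempty closed convex cone, $c\in\mathbb{R}^n$, $b\in\mathbb{R}^m$, and let $A\in\mathbb{R}^{m\times n}$ have full rank with $m\le n$. Let $\tilde T$ and $D$ be as defined in the context, and consider the iteration $z^{k+1}=T_3(z^k)=\tilde T(z^k)-\gamma Dc$, $k=0,1,\dots$, with any starting point $z^0\in\mathbb{R}^n$ and any $\gamma>0$. If (P) has an improving direction, then $$d=\lim_{k\to\infty}(z^{k+1}-z^k)=\gamma P_{\overline{K^*+\mathcal{R}(A^T)-c}}(\mathbf{0})\ne\mathbf{0}$$ is an improving direction. If (P) has no improving direction, then $$\lim_{k\to\infty}(z^{k+1}-z^k)=\mathbf{0}.$$
   Context: A set $K\subseteq\mathbb{R}^n$ is a cone if $K=\lambda K$ for every $\lambda>0$; its dual cone is $K^*=\{u\in\mathbb{R}^n\mid u^Tv\ge0\text{ for all }v\in K\}$. (P) is the problem: minimize $c^Tx$ subject to $Ax=b$, $x\in K$. An improving direction of (P) is a vector $u\in\mathcal{N}(A)\cap K$ with $c^Tu<0$, where $\mathcal{N}(A)$ is the null space of $A$; $\mathcal{R}(A^T)$ is the range of $A^T$. For a nonempty closed convex set $C$, $P_C$ is the Euclidean projection onto $C$ and $R_C(x)=2P_C(x)-x$. Define $\tilde T(z)=\frac12\left(z+R_{\mathcal{N}(A)}(R_K(z))\right)$ and $D=I-A^T(AA^T)^{-1}A$. The overline denotes closure and sums of sets are Minkowski sums. *)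

(* Defs.v *)
(* Vectors of R^n are column matrices, with the library (product) topology. *)
From mathcomp Require Import all_boot all_order all_algebra.
From mathcomp Require Import all_classical all_reals all_analysis.

Set Implicit Arguments.
Unset Strict Implicit.
Unset Printing Implicit Defensive.

Import Order.TTheory GRing.Theory Num.Theory.
Import numFieldNormedType.Exports.

Local Open Scope classical_set_scope.
Local Open Scope ring_scope.

Section Euclidean.
Context {R : realType} {n : nat}.
Implicit Types (x y u v : 'cV[R]_n) (C K : set 'cV[R]_n).

Definition dotv u v : R := (u^T *m v) 0 0.

(* The library norm `|x| on matrices is the sup norm. *)
Definition enorm x : R := Num.sqrt (dotv x x).

(* A point of C nearest to x, with default value 0; such a point exists and
   is unique when C is nonempty, closed and convex. *)
Definition euclid_proj C x : 'cV[R]_n :=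
  xget 0 [set p | C p /\ forall y, C y -> enorm (x - p) <= enorm (x - y)].

Definition euclid_refl C x : 'cV[R]_n := 2 *: euclid_proj C x - x.

Definition is_cone K : Prop :=
  forall l : R, 0 < l -> K = [set l *: x | x in K].

Definition dual_cone K : set 'cV[R]_n :=
  [set u | forall v, K v -> 0 <= dotv u v].

Definition minkowski_sum C K : set 'cV[R]_n :=
  [set x + y | x in C & y in K].

End Euclidean.

Definition nullspace {R : realType} {m n : nat} (A : 'M[R]_(m, n)) :
  set 'cV[R]_n := [set x | A *m x = 0].

Definition range_space {R : realType} {m n : nat} (A : 'M[R]_(m, n)) :
  set 'cV[R]_m := range (fun x : 'cV[R]_n => A *m x).

(* minimize c^T x subject to A x = b and x in K *)
Record conic_program (R : realType) (m n : nat) := ConicProgram {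
  cp_cost : 'cV[R]_n;
  cp_mat : 'M[R]_(m, n);
  cp_rhs : 'cV[R]_m;
  cp_cone : set 'cV[R]_n
}.

Definition improving_direction {R : realType} {m n : nat}
    (P : conic_program R m n) (u : 'cV[R]_n) : Prop :=
  (nullspace (cp_mat P) `&` cp_cone P) u /\ dotv (cp_cost P) u < 0.

Definition Ttilde {R : realType} {m n : nat} (A : 'M[R]_(m, n))
    (K : set 'cV[R]_n) (z : 'cV[R]_n) : 'cV[R]_n :=
  2^-1 *: (z + euclid_refl (nullspace A) (euclid_refl K z)).

Definition Dmx {R : realType} {m n : nat} (A : 'M[R]_(m, n)) : 'M[R]_n :=
  1%:M - A^T *m invmx (A *m A^T) *m A.

Definition T3 {R : realType} {m n : nat} (P : conic_program R m n) (g : R)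
    (z : 'cV[R]_n) : 'cV[R]_n :=
  Ttilde (cp_mat P) (cp_cone P) z - g *: (Dmx (cp_mat P) *m cp_cost P).

(* Main.v *)
Require Import Defs.
From mathcomp Require Import all_boot all_order all_algebra.
From mathcomp Require Import all_classical all_reals all_analysis.
From mathcomp Require Import ring lra.

(** Write v for the point of least norm in the closure S of the set
    (dual of K) + range(A^T) - c, and D for the orthogonal projection onto the
    null space N of A.

    Optimality of v along segments of S starting at v already locates it.
    S absorbs range(A^T), so v lies in N; S absorbs the dual cone, so
    nonnegativity of <v, .> on that cone and the bipolar theorem put v in K;
    S + c is a cone, so <v, v + c> = 0, that is <c, v> = - |v|^2.  Hence a
    nonzero v is itself an improving direction.  Conversely v + c is a limit
    of sums from the dual cone and range(A^T), so <v + c, u> >= 0 for u in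
    the intersection of K and N: if v = 0 there is no improving direction
    ([min_norm_null], [min_norm_cone], [dotv_cost_min_norm],
    [dotv_min_norm_cost_ge0]).

    It remains to prove that the differences of the iterates tend to g v.
    Splitting z = p - q by Moreau's decomposition, with p in K and q in the
    dual cone, p orthogonal to q, gives T z = D (p + q) - q - g D c
    ([T3E]).  From this formula T is firmly nonexpansive ([T3_firm]) and
    <T z - z, g v> >= |g v|^2 for every z ([displacement_dotv]).  The choice
    p = 0 gives T (- q) - (- q) = D (q - g c) for all q in the dual cone, and
    approximating v by elements of the sum makes the norms of these
    displacements approach |g v| ([displacement_approx]).

    These three facts suffice ([cvg_displacement]).  Compare the given orbit
    with the orbit of a point whose displacement is nearly of minimal norm.
    Firm nonexpansiveness makes the difference of the two displacements square
    summable, hence vanishing, and keeps the second displacement nearly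
    minimal forever; by the half-space inequality a displacement of nearly
    minimal norm is close to g v. *)

Set Implicit Arguments.
Unset Strict Implicit.
Unset Printing Implicit Defensive.

Import Order.TTheory GRing.Theory Num.Theory.
Import numFieldNormedType.Exports.

Local Open Scope classical_set_scope.
Local Open Scope ring_scope.

(** * The Euclidean inner product *)

Section DotProduct.
Context {R : realType} {n : nat}.
Implicit Types (u v w x : 'cV[R]_n) (a : R).

Lemma dotvE u v : dotv u v = \sum_i u i 0 * v i 0.
Proof. by rewrite /dotv mxE; apply: eq_bigr => i _; rewrite mxE. Qed.

Lemma dotvC u v : dotv u v = dotv v u.
Proof. by rewrite !dotvE; apply: eq_bigr => i _; rewrite mulrC. Qed.

Lemma dotvDl u v w : dotv (u + v) w = dotv u w + dotv v w.
Proof. by rewrite /dotv linearD mulmxDl mxE. Qed.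

Lemma dotvZl a u v : dotv (a *: u) v = a * dotv u v.
Proof. by rewrite /dotv linearZ -scalemxAl mxE. Qed.

Lemma dotvNl u v : dotv (- u) v = - dotv u v.
Proof. by rewrite -scaleN1r dotvZl mulN1r. Qed.

Lemma dotvDr u v w : dotv u (v + w) = dotv u v + dotv u w.
Proof. by rewrite dotvC dotvDl !(dotvC _ u). Qed.

Lemma dotvZr a u v : dotv u (a *: v) = a * dotv u v.
Proof. by rewrite dotvC dotvZl (dotvC v). Qed.

Lemma dotvNr u v : dotv u (- v) = - dotv u v.
Proof. by rewrite dotvC dotvNl (dotvC v). Qed.

Definition dotv_lin := (dotvDl, dotvDr, dotvNl, dotvNr, dotvZl, dotvZr).

Lemma dotv0l u : dotv 0 u = 0.
Proof. by rewrite -(scale0r u) dotvZl mul0r. Qed.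

Lemma dotvv_ge0 u : 0 <= dotv u u.
Proof. by rewrite dotvE; apply: sumr_ge0 => i _; rewrite -expr2 sqr_ge0. Qed.

Lemma coord_sqr_le_dotvv u i : u i 0 ^+ 2 <= dotv u u.
Proof.
rewrite dotvE (bigD1 i) //= -expr2 lerDl.
by apply: sumr_ge0 => j _; rewrite -expr2 sqr_ge0.
Qed.

Lemma dotvv_le0 u : dotv u u <= 0 -> u = 0.
Proof.
move=> u0; apply/matrixP => i j; rewrite ord1 mxE; apply/eqP.
by rewrite -sqrf_eq0 eq_le sqr_ge0 (le_trans (coord_sqr_le_dotvv _ _)).
Qed.

Lemma enorm_le u v : (enorm u <= enorm v) = (dotv u u <= dotv v v).
Proof. by rewrite /enorm ler_sqrt // dotvv_ge0. Qed.

End DotProduct.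

Lemma dotv_mulmxl (R : realType) (m n : nat) (M : 'M[R]_(m, n)) u v :
  dotv (M *m u) v = dotv u (M^T *m v).
Proof. by rewrite /dotv trmx_mul mulmxA. Qed.

(** * Topology of column vectors *)

Lemma continuous_matrix (T : topologicalType) (R : realType) (p q : nat)
    (f : T -> 'M[R]_(p, q)) :
  (forall i j, continuous (fun x => f x i j)) -> continuous f.
Proof.
move=> cf x; apply/cvg_ballP => e e0.
have H : \forall t \near x, forall i j, ball (f x i j) e (f t i j).
  apply: filter_forall => i; apply: filter_forall => j.
  by have /cvg_ballP /(_ e e0) := cf i j x.
by apply: filterS H => t H; split.
Qed.

Lemma mulmx_continuous (R : realType) (p q r : nat) (M : 'M[R]_(p, q)) :
  continuous (fun x : 'M[R]_(q, r) => M *m x).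
Proof.
apply: continuous_matrix => i j.
under eq_fun do rewrite mxE.
apply: continuous_big => [|k _ x]; first exact: add_continuous.
apply: continuousM; first exact: cst_continuous.
exact: (@coord_continuous R q r k j x).
Qed.

Lemma dotv_continuous (T : topologicalType) (R : realType) (n : nat)
    (f h : T -> 'cV[R]_n) :
  continuous f -> continuous h -> continuous (fun x => dotv (f x) (h x)).
Proof.
move=> cf ch; under eq_fun do rewrite dotvE.
apply: continuous_big => [|i _ x]; first exact: add_continuous.
apply: cvgM.
  exact: (continuous_comp (cf x) (@coord_continuous R n 1 i 0 _)).
exact: (continuous_comp (ch x) (@coord_continuous R n 1 i 0 _)).
Qed.

Lemma affine_continuous (R : realType) (n : nat) (l : R) (w : 'cV[R]_n) :
  continuous (fun s : 'cV[R]_n => l *: s + w).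
Proof.
move=> x; apply: (@continuousD _ _ _ (fun s => l *: s) (fun=> w)).
  by apply: continuousZl_tmp; exact: cvg_id.
exact: cst_continuous.
Qed.

(** Euclidean convergence implies convergence for the product topology, since
    each squared coordinate is bounded by the squared norm. *)
Lemma cvg_dotvv (R : realType) (n : nat) (w : nat -> 'cV[R]_n) d :
  dotv (w k - d) (w k - d) @[k --> \oo] --> (0 : R) -> w k @[k --> \oo] --> d.
Proof.
move=> /cvgrPdist_lt w0; apply/cvg_ballP => e e0.
have e20 : 0 < e ^+ 2 by rewrite exprn_gt0.
apply: filterS (w0 _ e20) => k; rewrite sub0r normrN ger0_norm ?dotvv_ge0 // => wk.
split=> // i j; rewrite ord1 /ball /= distrC.
rewrite -(ltr_pXn2r (n := 2)) ?nnegrE ?normr_ge0 // ?(ltW e0) //.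
rewrite real_normK ?num_real //.
by apply: le_lt_trans wk; have := coord_sqr_le_dotvv (w k - d) i; rewrite !mxE.
Qed.

Lemma closure_stable (T : topologicalType) (E : set T) (f : T -> T) :
  continuous f -> (forall x, E x -> E (f x)) ->
  forall x, closure E x -> closure E (f x).
Proof.
move=> cf sf x clx B /cf Bx; have [y [Ey By]] := clx _ Bx.
by exists (f y); split=> //; exact: sf.
Qed.

(** Heine-Borel for columns, transposed from a compact box of row vectors. *)
Lemma cV_bounded_closed_compact (R : realType) (n : nat) (C : set 'cV[R]_n) M :
  closed C -> (forall x i, C x -> `|x i 0| <= M) -> compact C.
Proof.
move=> clC bC.
have cT : continuous (fun x : 'rV[R]_n => x^T).
  apply: continuous_matrix => i j; under eq_fun do rewrite mxE.
  exact: coord_continuous.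
pose B := [set v : 'rV[R]_n | forall i, `[- M, M]%classic (v ord0 i)].
have cB : compact B.
  apply: (@rV_compact _ _ (fun=> `[- M, M]%classic)) => i.
  exact: segment_compact.
have : compact ((fun x : 'rV[R]_n => x^T) @` B).
  by apply: continuous_compact => //; exact: continuous_subspaceT.
move=> cTB; apply: (subclosed_compact clC cTB) => x Cx.
exists x^T; last by rewrite trmxK.
by move=> i /=; rewrite mxE in_itv /= -ler_norml bC.
Qed.

(** * Nearest points *)

Section Projection.
Context {R : realType} {n : nat}.
Implicit Types (C K : set 'cV[R]_n) (x y u p : 'cV[R]_n).

(** The defining property of [euclid_proj], on squared norms. *)
Definition nearest C x p :=
  C p /\ forall y, C y -> dotv (x - p) (x - p) <= dotv (x - y) (x - y).

(** A nearest point exists by compactness of the competitors in a ball; the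
    lemma thus applies directly to the closure of a Minkowski sum. *)
Lemma euclid_proj_nearest C x :
  closed C -> C !=set0 -> nearest C x (euclid_proj C x).
Proof.
move=> clC [y0 Cy0].
pose f y := dotv (x - y) (x - y).
have cf : continuous f.
  have cxy : continuous (fun y => x - y).
    by move=> y; apply: continuousB; [exact: cst_continuous|exact: cvg_id].
  exact: dotv_continuous.
suff [p [Cp minp]] : exists p, nearest C x p.
  have : [set p | C p /\ forall y, C y -> enorm (x - p) <= enorm (x - y)]
           (euclid_proj C x).
    by apply: xgetPex; exists p; split=> // y Cy; rewrite enorm_le; exact: minp.
  by case=> Cq minq; split=> // y Cy; rewrite -enorm_le; exact: minq.
(* Only points at least as close to x as y0 compete, and they are bounded. *)
pose B := C `&` [set y | f y <= f y0].
have clB : closed B.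
  apply: closedI => //; apply: (@closed_comp _ _ f [set r | r <= f y0]).
    by move=> y _; exact: cf.
  exact: closed_le.
have cB : compact B.
  (* The term f y0 + 1 comes from a <= a ^+ 2 + 1. *)
  apply: (@cV_bounded_closed_compact _ _ _ (\sum_i `|x i 0| + (f y0 + 1))) => //.
  move=> y i [Cy fy].
  have -> : y i 0 = x i 0 - (x - y) i 0 by rewrite !mxE; ring.
  apply: le_trans (ler_normB _ _) _; apply: lerD.
    by rewrite (bigD1 i) //= lerDl sumr_ge0.
  have := le_trans (coord_sqr_le_dotvv (x - y) i) fy.
  rewrite -real_normK ?num_real //; set a := `|_|.
  have := sqr_ge0 (a - 1); nra.
have [||p] := @compact_EVT_min _ R f B _ cB.
- by exists y0; split=> //=.
- exact: continuous_subspaceT.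
move=> /set_mem [Cp fp] minp; exists p; split=> // y Cy.
have [fy|fy] := leP (f y) (f y0); first by apply: minp; apply/mem_set.
by apply: le_trans fp (ltW fy).
Qed.

(** First-order optimality: moving from the nearest point p in a feasible
    direction u cannot decrease the distance to x to first order.  Asking for
    a single segment makes it usable on sets not known to be convex. *)
Lemma nearest_dotv_le0 C x p u : nearest C x p ->
  (forall t, 0 < t -> t <= 1 -> C (p + t *: u)) -> dotv (x - p) u <= 0.
Proof.
move=> [Cp minp] seg; rewrite leNgt; apply/negP.
set a := dotv (x - p) u => a0; pose b := dotv u u.
have b0 : 0 <= b by exact: dotvv_ge0.
(* A step at which the first-order gain 2 t a exceeds the loss t ^+ 2 * b. *)
pose t := a / (a + b).
have ab0 : 0 < a + b by lra.
have t0 : 0 < t by rewrite divr_gt0.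
have t1 : t <= 1 by rewrite ler_pdivrMr // mul1r; lra.
have := minp _ (seg t t0 t1).
have -> : x - (p + t *: u) = (x - p) - t *: u by rewrite opprD addrA.
move: (x - p) @a a0 ab0 @t t0 t1 => w; rewrite /= => a0 ab0 t0 t1.
rewrite !dotv_lin (dotvC u w) -/b.
move: (dotv w u) a0 ab0 t0 t1 => a a0 ab0.
set t := a / (a + b) => t0 t1.
have tE : t * (a + b) = a by rewrite /t divfK // gt_eqF.
have h : t * (2 * a - t * b) > 0.
  have -> : 2 * a - t * b = a + t * a by lra.
  by rewrite mulr_gt0 // addr_gt0 // mulr_gt0.
lra.
Qed.

End Projection.

(** * Moreau's decomposition for a closed convex cone *)

Section ConvexCone.
Context {R : realType} {n : nat} {K : set 'cV[R]_n}.
Hypotheses (K_neq0 : K !=set0) (K_closed : closed K).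
Hypothesis K_add : forall x y, K x -> K y -> K (x + y).
Hypothesis K_scale : forall (l : R) x, 0 < l -> K x -> K (l *: x).
Implicit Types (x y p q u v : 'cV[R]_n).

(** Let p be the projection of x.  The vector p - x is dual because p + t v stays
    in K for v in K, and orthogonal to p because K contains the ray through p,
    which extends on both sides of p. *)
Lemma moreau x : [/\ K (euclid_proj K x), dual_cone K (euclid_proj K x - x)
  & dotv (euclid_proj K x) (euclid_proj K x - x) = 0].
Proof.
have npx := euclid_proj_nearest x K_closed K_neq0.
have [Kp _] := npx; set p := euclid_proj K x in npx Kp *.
have dual : dual_cone K (p - x).
  move=> v Kv; rewrite -(opprB x) dotvNl oppr_ge0.
  by apply: (nearest_dotv_le0 npx) => t t0 _; apply: K_add => //; exact: K_scale.
split=> //; apply/eqP; rewrite eq_le; apply/andP; split; last first.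
  by rewrite dotvC; exact: dual.
(* Halving the inward direction - p keeps the segment off 0. *)
have := @nearest_dotv_le0 _ _ K x p (- (2^-1 *: p)) npx.
rewrite -(opprB x) !dotv_lin (dotvC p) => h.
suff /h : forall t : R, 0 < t -> t <= 1 -> K (p + t *: - (2^-1 *: p)) by lra.
move=> t t0 t1; rewrite scalerN scalerA -[X in X - _]scale1r -scalerBl.
by apply: K_scale => //; lra.
Qed.

Lemma euclid_proj_dual_opp q : dual_cone K q -> euclid_proj K (- q) = 0.
Proof.
move=> Kq; have [Kp _] := moreau (- q).
set p := euclid_proj K _ in Kp *; rewrite opprK dotvDr => h.
by apply: dotvv_le0; have := Kq _ Kp; rewrite dotvC; lra.
Qed.

(** Bipolar theorem: with p the projection of v, the vector p - v is dual and
    orthogonal to p, so its pairing with v is minus its squared norm. *)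
Lemma bidual_cone_sub v : (forall q, dual_cone K q -> 0 <= dotv v q) -> K v.
Proof.
move=> vq; have [Kp Kq pq] := moreau v.
set p := euclid_proj K v in Kp Kq pq *.
suff /eqP : p - v = 0 by rewrite subr_eq0 => /eqP <-.
apply: dotvv_le0; have := vq _ Kq; rewrite dotvDl pq dotvNl; lra.
Qed.

End ConvexCone.

Section ConeFacts.
Context {R : realType} {n : nat} (K : set 'cV[R]_n).

Lemma cone_scale : is_cone K -> forall (l : R) x, 0 < l -> K x -> K (l *: x).
Proof. by move=> Kc l x l0 Kx; rewrite (Kc l l0); exists x. Qed.

(** The sum is twice the midpoint. *)
Lemma convex_cone_add : is_cone K -> convex_set K ->
  forall x y, K x -> K y -> K (x + y).
Proof.
move=> Kc Kv x y Kx Ky.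
have h0 : 0 <= 2^-1 :> R by rewrite invr_ge0 ler0n.
have h1 : 2^-1 <= 1 :> R by rewrite invf_le1 ?ler1n // ltr0n.
have /set_mem := Kv x y (Itv01 h0 h1) (mem_set Kx) (mem_set Ky).
move=> /(cone_scale Kc (ltr0Sn R 1)).
rewrite /conv /= scalerDr !scalerA.
have -> : 2 * 2^-1 = 1 :> R by lra.
have -> : 2 * (1 - 2^-1) = 1 :> R by lra.
by rewrite !scale1r.
Qed.

End ConeFacts.

(** * Displacements of a firmly nonexpansive map *)

(** Asymptotic regularity.  The second and third hypotheses say that v is the
    point of least norm in the closed range of T - id; the conclusion compares
    the orbit z with the orbit y of a point with almost minimal displacement. *)
Lemma cvg_displacement (R : realType) (n : nat) (T : 'cV[R]_n -> 'cV[R]_n) v z :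
  (forall x y, dotv (T x - T y) (T x - T y) +
     dotv ((x - T x) - (y - T y)) ((x - T x) - (y - T y))
       <= dotv (x - y) (x - y)) ->
  (forall x, dotv v v <= dotv (T x - x) v) ->
  (forall e, 0 < e -> exists y, dotv (T y - y) (T y - y) < dotv v v + e) ->
  (forall k : nat, z k.+1 = T (z k)) ->
  (z k.+1 - z k) @[k --> \oo] --> v.
Proof.
move=> firm half approx zT; apply: cvg_dotvv; apply/cvgrPdist_lt => e e0.
have e40 : 0 < e / 4 by lra.
have [y0 y0e] := approx _ e40.
pose y k := iter k T y0.
pose b k := dotv (z k - y k) (z k - y k).
pose s k := (z k.+1 - z k) - (y k.+1 - y k).
pose a k := dotv (s k) (s k).
have ab k : a k <= b k - b k.+1.
  have := firm (z k) (y k); rewrite -zT -/(y k.+1) -/(b k) -/(b k.+1).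
  have -> : (z k - z k.+1) - (y k - y k.+1) = - s k.
    by apply/matrixP => i j; rewrite !mxE; ring.
  by rewrite dotvNl dotvNr opprK -/(a k); lra.
have bcvg : cvgn b.
  apply: nonincreasing_is_cvgn.
    apply/nonincreasing_seqP => k.
    by have := dotvv_ge0 (s k); have := ab k; rewrite /a; lra.
  by exists 0 => _ [k _ <-]; exact: dotvv_ge0.
have bd0 : (b k - b k.+1) @[k --> \oo] --> (0 : R).
  rewrite -(subrr (limn b)); apply: cvgB => //.
  by have := bcvg; rewrite -(cvg_shiftS b).
have yd k : dotv (y k.+1 - y k) (y k.+1 - y k) < dotv v v + e / 4.
  elim: k => [//|k IH]; apply: le_lt_trans IH.
  apply: le_trans (firm (y k.+1) (y k)).
  by rewrite lerDl dotvv_ge0.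
move/cvgrPdist_lt: bd0 => /(_ _ e40); apply: filterS => k.
rewrite !sub0r !normrN => hk.
rewrite ger0_norm ?dotvv_ge0 //.
have ak : a k < e / 4.
  by apply: le_lt_trans (ab k) _; apply: le_lt_trans (ler_norm _) hk.
have yk := yd k; have hy := half (y k); rewrite -/(y k.+1) in hy.
move: ak yk hy; rewrite /a /s.
move: (z k.+1 - z k) (y k.+1 - y k) => w u.
(* |w - v|^2 <= 2 |w - u|^2 + 2 |u - v|^2, and |u - v|^2 <= |u|^2 - |v|^2. *)
have := dotvv_ge0 ((w - u) - (u - v)).
rewrite !dotv_lin (dotvC u w) (dotvC v u) (dotvC v w); lra.
Qed.

(** * The orthogonal projector onto the null space *)

Section NullSpace.
Context {R : realType} {m n : nat} (A : 'M[R]_(m, n)).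
Hypothesis A_free : row_free A.
Implicit Types (u x : 'cV[R]_n).

(** Over the reals, v A A^T = 0 forces |v A|^2 = 0. *)
Lemma gram_unitmx : A *m A^T \in unitmx.
Proof.
rewrite -row_free_unit; apply: inj_row_free => v vG.
apply/eqP; rewrite -(mulmx_free_eq0 _ A_free) -trmx_eq0; apply/eqP.
apply: dotvv_le0.
by rewrite /dotv trmxK trmx_mul mulmxA -(mulmxA v) vG mul0mx mxE.
Qed.

Lemma mulmx_Dmx : A *m Dmx A = 0.
Proof. by rewrite mulmxBr mulmx1 !mulmxA mulmxV ?gram_unitmx // mul1mx subrr. Qed.

Lemma Dmx_sym : (Dmx A)^T = Dmx A.
Proof.
by rewrite /Dmx linearB /= trmx1 !trmx_mul trmxK trmx_inv trmx_mul trmxK mulmxA.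
Qed.

Lemma Dmx_mul_tr : Dmx A *m A^T = 0.
Proof. by rewrite -[LHS]trmxK trmx_mul Dmx_sym trmxK mulmx_Dmx trmx0. Qed.

Lemma Dmx_fix u : A *m u = 0 -> Dmx A *m u = u.
Proof. by move=> Au; rewrite mulmxBl mul1mx -!mulmxA Au !mulmx0 subr0. Qed.

Lemma dotv_Dmx u x : dotv (Dmx A *m u) x = dotv u (Dmx A *m x).
Proof. by rewrite dotv_mulmxl Dmx_sym. Qed.

Lemma Dmx_idem u : Dmx A *m (Dmx A *m u) = Dmx A *m u.
Proof. by apply: Dmx_fix; rewrite mulmxA mulmx_Dmx mul0mx. Qed.

Lemma nullspace_closed : closed (nullspace A).
Proof.
apply: (@closed_comp _ _ (fun x : 'cV[R]_n => A *m x) [set 0]).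
  by move=> x _; exact: mulmx_continuous.
apply: accessible_closed_set1; apply: hausdorff_accessible.
exact: norm_hausdorff.
Qed.

Lemma euclid_proj_nullspace x : euclid_proj (nullspace A) x = Dmx A *m x.
Proof.
have N0 : nullspace A !=set0 by exists 0; rewrite /nullspace /= mulmx0.
have ND u v : nullspace A u -> nullspace A v -> nullspace A (u + v).
  by rewrite /nullspace /= => Au Av; rewrite mulmxDr Au Av addr0.
have NZ (l : R) u : 0 < l -> nullspace A u -> nullspace A (l *: u).
  by rewrite /nullspace /= => _ Au; rewrite -scalemxAr Au scaler0.
have [Np dual _] := moreau N0 nullspace_closed ND NZ x.
move: Np dual; set p := euclid_proj _ x => Np dual.
have Nd : nullspace A (Dmx A *m x - p).
  by rewrite /nullspace /= mulmxBr mulmxA mulmx_Dmx mul0mx Np subr0.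
apply/esym/eqP; rewrite -subr_eq0; apply/eqP/dotvv_le0.
have := dual _ Nd.
have -> : dotv (p - x) (Dmx A *m x - p) = dotv (Dmx A *m (p - x)) (Dmx A *m x - p).
  by rewrite dotv_Dmx (Dmx_fix Nd).
rewrite mulmxBr (Dmx_fix Np) -(opprB (Dmx A *m x)) dotvNl; lra.
Qed.

End NullSpace.

(** * The iteration operator and the point of least norm *)

Section DouglasRachford.
Context {R : realType} {m n : nat} (K : set 'cV[R]_n) (c : 'cV[R]_n)
  (b : 'cV[R]_m) (A : 'M[R]_(m, n)) (g : R).
Hypotheses (K_neq0 : K !=set0) (K_closed : closed K).
Hypothesis K_add : forall x y, K x -> K y -> K (x + y).
Hypothesis K_scale : forall (l : R) x, 0 < l -> K x -> K (l *: x).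
Hypotheses (A_free : row_free A) (g_gt0 : 0 < g).
Implicit Types (x y p q u v z : 'cV[R]_n).

Local Notation D := (Dmx A).
Local Notation T := (T3 (ConicProgram c A b K) g).

Lemma T3E z (p := euclid_proj K z) (q := p - z) :
  T z = D *m (p + q) - q - g *: (D *m c).
Proof.
rewrite /T3 /Ttilde /= /euclid_refl -/p euclid_proj_nullspace //.
have -> : 2 *: p - z = p + q by rewrite scaler_nat mulr2n /q addrA.
congr (_ - _); rewrite /q.
set w := D *m _; apply/matrixP => i j; by rewrite !mxE; field.
Qed.

(** With dp, dq the increments of the two Moreau components and s = dp + dq,
    the left-hand side is |dp|^2 + |dq|^2 because D is an orthogonal projector,
    while the right-hand side is |dp|^2 + |dq|^2 - 2 <dp, dq>; mutual polarity
    of p and q makes <dp, dq> nonpositive. *)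
Lemma T3_firm x y : dotv (T x - T y) (T x - T y) +
  dotv ((x - T x) - (y - T y)) ((x - T x) - (y - T y)) <= dotv (x - y) (x - y).
Proof.
rewrite !T3E; set d := g *: _.
have [Kp Kq pq] := moreau K_neq0 K_closed K_add K_scale x.
have [Kp' Kq' pq'] := moreau K_neq0 K_closed K_add K_scale y.
move: Kp Kq pq Kp' Kq' pq'.
set p := euclid_proj K x; set q := p - x.
set p' := euclid_proj K y; set q' := p' - y.
move=> Kp Kq pq Kp' Kq' pq'.
have c1 := Kq _ Kp'; have c2 := Kq' _ Kp.
have xE : x = p - q by rewrite /q subKr.
have yE : y = p' - q' by rewrite /q' subKr.
clearbody p q p' q'.
pose dp := p - p'; pose dq := q - q'; pose s := dp + dq.
have TE : (D *m (p + q) - q - d) - (D *m (p' + q') - q' - d) = D *m s - dq.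
  have -> : s = (p + q) - (p' + q') by apply/matrixP => i j; rewrite !mxE; ring.
  by rewrite mulmxBr; apply/matrixP => i j; rewrite !mxE; ring.
have -> : x - (D *m (p + q) - q - d) - (y - (D *m (p' + q') - q' - d))
   = dp - D *m s.
  have -> : dp - D *m s = (x - y) - (D *m s - dq).
    by rewrite [in RHS]xE [in RHS]yE; apply/matrixP => i j; rewrite !mxE; ring.
  by rewrite -TE; apply/matrixP => i j; rewrite !mxE; ring.
rewrite TE.
have -> : x - y = dp - dq.
  by rewrite xE yE; apply/matrixP => i j; rewrite !mxE; ring.
have Ds : dotv (D *m s) (D *m s) = dotv (D *m s) dp + dotv (D *m s) dq.
  by rewrite -dotvDr -/s dotv_Dmx // Dmx_idem // dotvC.
have pq0 : dotv dp dq <= 0.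
  rewrite /dp /dq !dotv_lin pq pq' (dotvC p') (dotvC p); lra.
clearbody dp dq s.
move: Ds; rewrite !dotv_lin (dotvC dq (D *m s)) (dotvC dp (D *m s)) (dotvC dq dp).
lra.
Qed.

Local Notation E := (minkowski_sum
  (minkowski_sum (dual_cone K) (range_space A^T)) [set - c]).
Local Notation v := (euclid_proj (closure E) 0).

Lemma sum_setP s : E s <->
  exists2 q, dual_cone K q & exists y : 'cV[R]_m, s = q + A^T *m y - c.
Proof.
split=> [[_ [q Kq [_ [y _ <-] <-]] [_ -> <-]]|[q Kq [y ->]]].
  by exists q => //; exists y.
exists (q + A^T *m y); last by exists (- c).
by exists q => //; exists (A^T *m y) => //; exists y.
Qed.

Lemma closure_sum_scale (l : R) s :
  0 < l -> closure E s -> closure E (l *: (s + c) - c).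
Proof.
move=> l0.
apply: (@closure_stable _ _ (fun s : 'cV[R]_n => l *: (s + c) - c)).
  under eq_fun do rewrite scalerDr -addrA.
  exact: affine_continuous.
move=> x /sum_setP [q Kq [y ->]]; apply/sum_setP; exists (l *: q).
  by move=> u Ku; rewrite dotvZl mulr_ge0 ?(ltW l0) ?Kq.
by exists (l *: y); rewrite subrK scalerDr scalemxAr.
Qed.

Lemma closure_sum_add s q (y : 'cV[R]_m) : dual_cone K q ->
  closure E s -> closure E (s + (q + A^T *m y)).
Proof.
move=> Kq.
apply: (@closure_stable _ _ (fun s : 'cV[R]_n => s + (q + A^T *m y))).
  under eq_fun do rewrite -[X in X + _]scale1r.
  exact: affine_continuous.
move=> x /sum_setP [q' Kq' [y' ->]]; apply/sum_setP; exists (q' + q).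
  by move=> u Ku; rewrite dotvDl addr_ge0 ?Kq ?Kq'.
by exists (y' + y); rewrite mulmxDr -addrAC [in RHS]addrACA.
Qed.

Lemma min_norm_nearest : nearest (closure E) 0 v.
Proof.
apply: euclid_proj_nearest; first exact: closed_closure.
exists (0 + A^T *m 0 - c); apply: subset_closure; apply/sum_setP; exists 0.
  by move=> u _; rewrite dotv0l.
by exists 0.
Qed.

Lemma dotv_min_norm_ge0 q (y : 'cV[R]_m) :
  dual_cone K q -> 0 <= dotv v (q + A^T *m y).
Proof.
move=> Kq; rewrite -[leLHS]oppr0 -[leRHS]opprK lerN2 -dotvNl -sub0r.
apply: (nearest_dotv_le0 min_norm_nearest) => t t0 _.
rewrite scalerDr scalemxAr; apply: closure_sum_add; last by case: min_norm_nearest.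
by move=> u Ku; rewrite dotvZl mulr_ge0 ?(ltW t0) ?Kq.
Qed.

(** Moving by - A^T (A v) stays in the set, so <v, - A^T (A v)> = - |A v|^2
    cannot be negative. *)
Lemma min_norm_null : A *m v = 0.
Proof.
apply: dotvv_le0; rewrite dotv_mulmxl.
have K0 : dual_cone K 0 by move=> u _; rewrite dotv0l.
by have := dotv_min_norm_ge0 (- (A *m v)) K0; rewrite add0r mulmxN dotvNr oppr_ge0.
Qed.

Lemma min_norm_cone : K v.
Proof.
apply: bidual_cone_sub => // q Kq.
by have := dotv_min_norm_ge0 0 Kq; rewrite mulmx0 addr0.
Qed.

(** v + c lies in a cone, and rescaling it up and down gives <v, v + c> = 0. *)
Lemma dotv_cost_min_norm : dotv c v = - dotv v v.
Proof.
have nv := min_norm_nearest; have Ev := nv.1.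
have h1 : dotv (0 - v) (v + c) <= 0.
  apply: (nearest_dotv_le0 nv) => t t0 _.
  have -> : v + t *: (v + c) = (1 + t) *: (v + c) - c.
    by rewrite scalerDl scale1r [in RHS]addrAC addrK.
  by apply: closure_sum_scale => //; lra.
have h2 : dotv (0 - v) (- (2^-1 *: (v + c))) <= 0.
  apply: (nearest_dotv_le0 nv) => t t0 t1.
  have -> : v + t *: - (2^-1 *: (v + c)) = (1 - t * 2^-1) *: (v + c) - c.
    by rewrite scalerBl scale1r scalerN scalerA [in RHS]addrAC addrK.
  by apply: closure_sum_scale => //; lra.
move: h1 h2; rewrite sub0r !dotv_lin (dotvC v c); lra.
Qed.

(** The closed half-space of all s with <s + c, u> >= 0 contains the sum, hence
    its closure, when u is in K and in the null space. *)
Lemma dotv_min_norm_cost_ge0 u : nullspace A u -> K u -> 0 <= dotv (v + c) u.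
Proof.
move=> Au Ku; have [Ev _] := min_norm_nearest.
have cl : closed [set s | 0 <= dotv (s + c) u].
  apply: (@closed_comp _ _ (fun s : 'cV[R]_n => dotv (s + c) u) [set r | 0 <= r]).
    move=> x _; apply: dotv_continuous; last exact: cst_continuous.
    under eq_fun do rewrite -[X in X + _]scale1r.
    exact: affine_continuous.
  exact: closed_ge.
suff : closure [set s | 0 <= dotv (s + c) u] v.
  by rewrite -(proj1 (closure_id _) cl).
apply: closure_subset Ev => s.
move=> /sum_setP [q Kq [y ->]] /=.
rewrite subrK dotvDl dotv_mulmxl trmxK Au (dotvC _ 0) dotv0l addr0.
exact: Kq.
Qed.

(** T x - x = D q - (p - D p) - g D c, and v is fixed by D, so the pairing with v
    is <q, v> - g <c, v> = <q, v> + g |v|^2, where <q, v> >= 0 as v is in K. *)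
Lemma displacement_dotv x : dotv (g *: v) (g *: v) <= dotv (T x - x) (g *: v).
Proof.
have [Kp Kq _] := moreau K_neq0 K_closed K_add K_scale x.
rewrite T3E; move: Kp Kq; set p := euclid_proj K x; set q := p - x => Kp Kq.
have Dv : D *m v = v by exact: Dmx_fix min_norm_null.
have qv := Kq _ min_norm_cone.
have xE : x = p - q by rewrite /q subKr.
clearbody p q; rewrite xE mulmxDr !dotv_lin !dotv_Dmx // Dv dotv_cost_min_norm.
have := mulr_ge0 (ltW g_gt0) qv; nra.
Qed.

(** Start from - g q with q in the dual cone: its projection onto K is 0, which
    leaves the displacement D (g (q + A^T y - c)) for every y; by continuity
    this has nearly the norm of D (g v) = g v when q + A^T y - c is near v. *)
Lemma displacement_approx e : 0 < e -> exists y,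
  dotv (T y - y) (T y - y) < dotv (g *: v) (g *: v) + e.
Proof.
move=> e0; have [Ev _] := min_norm_nearest.
pose f (s : 'cV[R]_n) := dotv (D *m (g *: s)) (D *m (g *: s)).
have cf : continuous f.
  have cD : continuous (fun s : 'cV[R]_n => D *m (g *: s)).
    under eq_fun do rewrite -scalemxAr scalemxAl.
    exact: mulmx_continuous.
  exact: dotv_continuous.
have fv : f v = dotv (g *: v) (g *: v).
  by rewrite /f -scalemxAr Dmx_fix // min_norm_null.
have /cvgrPdist_lt /(_ _ e0) /Ev [_ [/sum_setP [q Kq [y ->]]]] /= := cf v.
rewrite fv distrC => lt.
pose q' := g *: q.
have Kq' : dual_cone K q' by move=> u Ku; rewrite dotvZl mulr_ge0 ?(ltW g_gt0) ?Kq.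
exists (- q'); rewrite T3E (euclid_proj_dual_opp K_neq0 K_closed K_add K_scale Kq').
have -> : D *m (0 + (0 - - q')) - (0 - - q') - g *: (D *m c) - - q'
   = D *m (g *: (q + A^T *m y - c)).
  have Dr : D *m (g *: (A^T *m y)) = 0.
    by rewrite -scalemxAr mulmxA Dmx_mul_tr // mul0mx scaler0.
  rewrite sub0r opprK add0r.
  rewrite scalerBr scalerDr mulmxBr mulmxDr Dr addr0 -[D *m (g *: c)]scalemxAr.
  by rewrite addrAC subrK.
rewrite -/(f _); have := le_lt_trans (ler_norm _) lt; lra.
Qed.

End DouglasRachford.

Theorem theorem10 (R : realType) (m n : nat) (K : set 'cV[R]_n)
  (c : 'cV[R]_n) (b : 'cV[R]_m) (A : 'M[R]_(m, n))
  (K_neq0 : K !=set0) (K_closed : closed K)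
  (K_convex : convex_set K) (K_cone : is_cone K)
  (le_mn : (m <= n)%N) (A_full : \rank A = minn m n)
  (g : R) (g_gt0 : 0 < g)
  (z : nat -> 'cV[R]_n)
  (z_rec : forall k : nat, z k.+1 = T3 (ConicProgram c A b K) g (z k)) :
  ((exists u : 'cV[R]_n, improving_direction (ConicProgram c A b K) u) ->
    exists d : 'cV[R]_n,
      [/\ (z k.+1 - z k) @[k --> \oo] --> d,
          d = g *: euclid_proj (closure (minkowski_sum
                (minkowski_sum (dual_cone K) (range_space A^T)) [set - c])) 0,
          d <> 0
        & improving_direction (ConicProgram c A b K) d]) /\
  (~ (exists u : 'cV[R]_n, improving_direction (ConicProgram c A b K) u) ->
    (z k.+1 - z k) @[k --> \oo] --> (0 : 'cV[R]_n)).
Proof.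
have A_free : row_free A by rewrite /row_free A_full (minn_idPl le_mn).
have KD := convex_cone_add K_cone K_convex.
have KZ := cone_scale K_cone.
set v := euclid_proj _ 0.
have lim : (z k.+1 - z k) @[k --> \oo] --> g *: v.
  apply: cvg_displacement z_rec.
  - exact: T3_firm.
  - exact: displacement_dotv.
  - exact: displacement_approx.
have Av : A *m v = 0 by exact: min_norm_null.
have Kv : K v by exact: min_norm_cone.
have cv : dotv c v = - dotv v v by exact: dotv_cost_min_norm.
have vcN u : nullspace A u -> K u -> 0 <= dotv (v + c) u.
  exact: dotv_min_norm_cost_ge0.
have imp : v <> 0 -> improving_direction (ConicProgram c A b K) (g *: v).
  move=> v0; split=> /=.
    by split; [rewrite /nullspace /= -scalemxAr Av scaler0|exact: KZ].
  rewrite dotvZr cv pmulr_rlt0 // oppr_lt0 lt_neqAle dotvv_ge0 andbT eq_sym.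
  by apply/eqP => vv; apply: v0; apply: dotvv_le0; rewrite vv.
split=> [[u [[Au Ku] cu]]|noimp].
  have v0 : v <> 0.
    by move=> v0; have := vcN u Au Ku; rewrite v0 add0r leNgt cu.
  exists (g *: v); split=> //; last exact: imp.
  by apply/eqP; rewrite scaler_eq0 negb_or gt_eqF //=; apply/eqP.
have -> : (0 : 'cV[R]_n) = g *: v; last exact: lim.
have [->|/eqP v0] := eqVneq v 0; first by rewrite scaler0.
by case: noimp; exists (g *: v); exact: imp.
Qed.
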